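(* Let $(\mathscr G_0,\mathscr G_1)$ be uncertainty classes for which a finite-sample minimax robust (FMR) test exists with least favorable distributions $(\hat G_0,\hat G_1)\in\mathscr G_0\times\mathscr G_1$. Then an asymptotically minimax robust (AMR) test exists for the same uncertainty classes $(\mathscr G_0,\mathscr G_1)$ and with the same least favorable distributions $(\hat G_0,\hat G_1)$. In particular, FMR $\Longrightarrow$ AMR.
   Context: Setting: $\mathscr G_0,\mathscr G_1$ are sets of probability measures on $\Omega$, absolutely continuous with respect to a common measure $\mu$; the density of $G_j$ is $g_j$. Under hypothesis $\mathcal H_j$ the observations $\boldsymbol Y=(Y_1,\dots,Y_n)$ are i.i.d. with distribution $G_j\in\mathscr G_j$ (probabilities $G_j[\cdot]$ of events depending on $\boldsymbol Y$ are taken under this i.i.d. law). For a pair $(\hat G_0,\hat G_1)\in\mathscr G_0\times\mathscr G_1$ put $\hat l=\hat g_1/\hat g_0$, $X_k=\log\hat l(Y_k)$ and $S_n(\boldsymbol X)=\frac1n\sum_{k=1}^nX_k$. Single-sample minimax robustness (SMR): the likelihood ratio test induced by $(\hat G_0,\hat G_1)$ is SMR if for $n=1$, for all $t\in\mathbb R$ and all $(G_0,G_1)\in\mathscr G_0\times\mathscr G_1$, $$G_0[\hat l(Y)<t]\ge\hat G_0[\hat l(Y)<t],\qquad G_1[\hat l(Y)<t]\le\hat G_1[\hat l(Y)<t].$$ Finite-sample minimax robustness (FMR): the test is minimax robust for every finite sample size $n$; equivalently, the two inequalities above hold for every finite $n$ with $\hat l(Y)$ replaced by the joint likelihood ratio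 $\prod_{k=1}^n\hat l(Y_k)$. The pair $(\hat G_0,\hat G_1)$ is then called the pair of least favorable distributions of the FMR test. Standing regularity assumption for AMR (uniform exponential moments): there is $\varepsilon>0$ such that $\mathbb E_{G_j}[e^{uX_k}]<\infty$ for all $|u|<\varepsilon$, $j\in\{0,1\}$, and every $(G_0,G_1)\in\mathscr G_0\times\mathscr G_1$. (Elements of the classes violating this are regarded as removed from the classes.) Threshold separation: a real number $t$ satisfies threshold separation if $\mathbb E_{G_0}[X_k]<t<\mathbb E_{G_1}[X_k]$ for all $(G_0,G_1)\in\mathscr G_0\times\mathscr G_1$. Asymptotic minimax robustness (AMR): under the uniform exponential moments assumption, the test based on $(\hat G_0,\hat G_1)$ is AMR if, for a threshold $t$ satisfying threshold separation, $$\lim_{n\to\infty}\tfrac1n\log G_0[S_n(\boldsymbol X)>t]\le\lim_{n\to\infty}\tfrac1n\log\hat G_0[S_n(\boldsymbol X)>t],$$ $$\lim_{n\to\infty}\tfrac1n\log G_1[S_n(\boldsymbol X)\le t]\le\lim_{n\to\infty}\tfrac1n\log\hat G_1[S_n(\boldsymbol X)\le t]$$ hold for all $(G_0,G_1)\in\mathscr G_0\times\mathscr G_1$. *)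

(* Defs.v *)
From HB Require Import structures.
From mathcomp Require Import all_boot all_order all_algebra.
From mathcomp Require Import all_classical all_reals all_analysis.
From mathcomp Require Import measurable_realfun.

Set Implicit Arguments.
Unset Strict Implicit.
Unset Printing Implicit Defensive.

Import Order.TTheory GRing.Theory Num.Theory.
Import numFieldNormedType.Exports.

Local Open Scope classical_set_scope.
Local Open Scope ring_scope.
Local Open Scope ereal_scope.

Section ProductImage.
Context {d1 d2 d3 : measure_display} {T1 : measurableType d1}
  {T2 : measurableType d2} {T3 : measurableType d3} {R : realType}.
Variables (P : probability T1 R) (Q : probability T2 R).
Variables (f : T1 * T2 -> T3) (mf : measurable_fun setT f).

Definition product_image of measurable_fun setT f : set T3 -> \bar R :=
  pushforward (P \x Q) f.

Let mu := product_image mf.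

Let mu0 : mu set0 = 0.
Proof. by rewrite /mu /product_image /pushforward preimage_set0 measure0. Qed.

Let mu_ge0 A : 0 <= mu A.
Proof. by rewrite /mu /product_image /pushforward measure_ge0. Qed.

Let mu_sigma_additive : semi_sigma_additive mu.
Proof.
have mpre A : measurable A -> measurable (f @^-1` A).
  by move=> mA; rewrite -[X in measurable X]setTI; exact: mf.
move=> F mF tF mUF; rewrite /mu /product_image /pushforward preimage_bigcup.
apply: measure_semi_sigma_additive.
- by move=> i; exact: mpre.
- apply/trivIsetP => i j _ _ ij; rewrite -preimage_setI.
  by move/trivIsetP : tF => /(_ i j Logic.I Logic.I ij) ->; rewrite preimage_set0.
- by rewrite -preimage_bigcup; exact: mpre.
Qed.

Let mu_setT : mu setT = 1.
Proof.
rewrite /mu /product_image /pushforward preimage_setT -setXTT.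
rewrite product_measure1E// -[RHS]mule1.
exact: (congr2 mule (probability_setT P) (probability_setT Q)).
Qed.

HB.instance Definition _ := isMeasure.Build _ _ _ (product_image mf)
  mu0 mu_ge0 mu_sigma_additive.

HB.instance Definition _ :=
  Measure_isProbability.Build _ _ _ (product_image mf) mu_setT.
End ProductImage.

Section IidLaw.
Context {d : measure_display} {T : measurableType d} {R : realType}.

Definition cons_tuple n (p : T * n.-tuple T) : n.+1.-tuple T :=
  [tuple of p.1 :: p.2].

Lemma measurable_cons_tuple n : measurable_fun setT (@cons_tuple n).
Proof. exact: (@measurable_cons _ _ (T * n.-tuple T)%type T fst n snd). Qed.

(* The law of [n] i.i.d. observations with distribution [G]: the [n]-fold
   product measure on [n]-tuples (see [iid_lawE]). *)
Fixpoint iid_law (G : probability T R) (n : nat) : probability (n.-tuple T) R :=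
  match n with
  | 0%N => \d_ [tuple]
  | m.+1 => product_image G (iid_law G m) (@measurable_cons_tuple m)
  end.

Lemma iid_lawE (G : probability T R) n (A : 'I_n -> set T) :
  (forall i, measurable (A i)) ->
  iid_law G n [set y | forall i, A i (tnth y i)] = \prod_(i < n) G (A i).
Proof.
elim: n A => [|n IHn] A mA.
  rewrite big_ord0 /= diracE mem_set//.
  by case.
rewrite big_ord_recl /= /product_image /pushforward.
rewrite -(IHn (fun i => A (lift ord0 i)))//.
pose B := [set y : n.-tuple T | forall i, A (lift ord0 i) (tnth y i)].
have mB : measurable B.
  rewrite (_ : B = \bigcap_(i in [set: 'I_n])
      ((@tnth n T ^~ i) @^-1` A (lift ord0 i))).
    apply: fin_bigcap_measurable => // i _; rewrite -[X in measurable X]setTI.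
    exact: measurable_tnth.
  by apply/seteqP; split => [y yB i _|y yB i]; [exact: yB|exact: (yB i)].
rewrite -product_measure1E//; congr ((G \x _) _).
apply/seteqP; split => -[x y] /=.
  move=> h; split; first exact: (h ord0).
  by move=> i; have := h (lift ord0 i); rewrite /cons_tuple tnthS.
move=> [h0 h] i; case: (unliftP ord0 i) => [j|] ->.
  by rewrite /cons_tuple tnthS; exact: h.
exact: h0.
Qed.
End IidLaw.

Section Robustness.
Context {d : measure_display} {T : measurableType d} {R : realType}.
Implicit Types (G : probability T R) (l : T -> \bar R).

Definition is_density (mu : {measure set T -> \bar R}) G (g : T -> R) : Prop :=
  [/\ measurable_fun [set: T] g, (forall x, (0 <= g x)%R) &
      forall A, measurable A -> G A = \int[mu]_(x in A) (g x)%:E].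

(* [l = g1 / g0] in [0, +oo], with [c / 0 = +oo] for [c > 0]; the value of the
   ratio where both densities vanish is left unspecified. *)
Definition is_likelihood_ratio (g0 g1 : T -> R) l : Prop :=
  [/\ measurable_fun [set: T] l, (forall x, 0 <= l x) &
      forall x, (g0 x != 0)%R || (g1 x != 0)%R ->
        l x = (g1 x)%:E / (g0 x)%:E].

Definition joint_lr l n (y : n.-tuple T) : \bar R :=
  \prod_(k < n) l (tnth y k).

(* [lne 0 = -oo] and [lne +oo = +oo]. *)
Definition llr l (x : T) : \bar R := lne (l x).

Definition mean_llr l n (y : n.-tuple T) : \bar R :=
  (n%:R^-1)%:E * \sum_(k < n) llr l (tnth y k).

Definition FMR (C0 C1 : set (probability T R)) (Gh0 Gh1 : probability T R) l :
    Prop :=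
  [/\ C0 Gh0, C1 Gh1 &
   forall (n : nat) (t : R) (G0 G1 : probability T R),
     (0 < n)%N -> C0 G0 -> C1 G1 ->
     iid_law Gh0 n [set y | joint_lr l y < t%:E] <=
       iid_law G0 n [set y | joint_lr l y < t%:E] /\
     iid_law G1 n [set y | joint_lr l y < t%:E] <=
       iid_law Gh1 n [set y | joint_lr l y < t%:E]].

Definition uniform_exp_moments (C0 C1 : set (probability T R)) l : Prop :=
  exists2 e : R, (0 < e)%R &
    forall (u : R) G, (`|u| < e)%R -> C0 G \/ C1 G ->
      \int[G]_x expeR (u%:E * llr l x) < +oo.

Definition threshold_separation (C0 C1 : set (probability T R)) l (t : R) :
    Prop :=
  forall G0 G1 : probability T R, C0 G0 -> C1 G1 ->
    \int[G0]_x llr l x < t%:E /\ t%:E < \int[G1]_x llr l x.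

(* [log 0 = -oo] here. *)
Definition log_error_rate G (E : forall n, set (n.-tuple T)) (n : nat) :
    \bar R :=
  (n%:R^-1)%:E * lne (iid_law G n (E n)).

(* The existence of the limits is part of the claim. *)
Definition lim_le (u v : nat -> \bar R) : Prop :=
  [/\ cvgn u, cvgn v & limn u <= limn v].

(* The threshold is an arbitrary one satisfying threshold separation. *)
Definition AMR (C0 C1 : set (probability T R)) (Gh0 Gh1 : probability T R) l :
    Prop :=
  [/\ C0 Gh0, C1 Gh1 &
   forall t : R, threshold_separation C0 C1 l t ->
   forall G0 G1 : probability T R, C0 G0 -> C1 G1 ->
     let above n := [set y : n.-tuple T | t%:E < mean_llr l y] in
     let below n := [set y : n.-tuple T | mean_llr l y <= t%:E] in
     lim_le (log_error_rate G0 above) (log_error_rate Gh0 above) /\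
     lim_le (log_error_rate G1 below) (log_error_rate Gh1 below)].

End Robustness.

(* Main.v *)
Require Import Defs.
From HB Require Import structures.
From mathcomp Require Import all_boot all_order all_algebra.
From mathcomp Require Import all_classical all_reals all_analysis.
From mathcomp Require Import measurable_realfun.

Local Open Scope classical_set_scope.
Local Open Scope ring_scope.
Local Open Scope ereal_scope.

(** Superadditivity replaces Cramér's theorem: concatenating two samples whose
    mean log-likelihood ratios lie on the same side of [t] gives a sample with
    the same property, so the logarithms of the error probabilities are
    superadditive in [n] and Fekete's lemma yields the limits. The events [mean_llr l y <= t] and
    [joint_lr l y <= exp (n t)] coincide, and FMR, whose inequalities bear on
    [joint_lr l y < s], extends to them by continuity from above; the error
    probabilities are therefore ordered for each [n > 0], and so are their
    exponential rates. *)

Import Order.TTheory GRing.Theory Num.Theory.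
Import numFieldNormedType.Exports.

(** * Fekete's lemma for nonnegative subadditive sequences *)

(** Peel off one block of size [k] at a time. The leftover [s] stays positive because subadditivity
    is assumed at positive indices only. *)
Lemma subadditive_mulnD {R : realType} {a : nat -> R} :
  (forall m n, (0 < m)%N -> (0 < n)%N -> (a (m + n)%N <= a m + a n)%R) ->
  forall k s q, (0 < k)%N -> (0 < s)%N ->
  (a (q * k + s)%N <= q%:R * a k + a s)%R.
Proof.
move=> subadd k s q k0 s0; elim: q => [|q IHq]; first by rewrite mul0r add0r.
rewrite mulSn -addnA -natr1 mulrDl mul1r [(_ + a k)%R]addrC -addrA.
apply: (le_trans (subadd _ _ k0 _)); first by rewrite addn_gt0 s0 orbT.
by rewrite lerD2l.
Qed.

(** The limit is the infimum of the quotients over positive indices, which nonnegativity makes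
    finite: an index nearly attaining it controls all large [n] through division with remainder. *)
Lemma fekete {R : realType} {a : nat -> R} :
  (forall n, (0 <= a n)%R) ->
  (forall m n, (0 < m)%N -> (0 < n)%N -> (a (m + n)%N <= a m + a n)%R) ->
  cvgn (fun n => (a n / n%:R)%R).
Proof.
move=> a0 subadd.
pose S := [set (a n.+1 / n.+1%:R)%R | n in [set: nat]].
have lbS : has_lbound S.
  by exists 0%R => _ [n _ <-]; rewrite divr_ge0.
have infS : has_inf S by split=> //; exists (a 1%N / 1%:R)%R; exists 0%N.
suff lim_inf : (fun n => (a n / n%:R)%R) @ \oo --> inf S.
  by apply/cvg_ex; exists (inf S).
apply/cvgrPdist_le => e e0.
have e20 : (0 < e / 2)%R by rewrite divr_gt0.
have [_ [k _ <-] ke] := inf_adherent e20 infS.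
(* [C] bounds [a s] for every [s] from [1] to [k.+1] and does not depend on [n], so [C / n] tends to
   [0]. *)
pose C := (\sum_(i < k.+1) a i.+1)%R.
near=> n.
have n0 : (0 < n)%N by near: n; exact: nbhs_infty_gt.
have nR0 : (0 < n%:R :> R)%R by rewrite ltr0n.
have lb : (inf S <= a n / n%:R)%R.
  by apply: ge_inf => //; exists n.-1 => //; rewrite prednK.
have Cn : (C / n%:R <= e / 2)%R.
  rewrite ler_pdivrMr// mulrC -ler_pdivrMr//.
  by near: n; exact: nbhs_infty_ger.
(* Dividing [n.-1] and raising the remainder by one leaves a block of size between [1] and [k.+1]:
   it is positive, and its value is a summand of [C]. *)
have an : (a n <= (n.-1 %/ k.+1)%:R * a k.+1 + C)%R.
  rewrite -[in leLHS](prednK n0) [in leLHS](divn_eq n.-1 k.+1) -addnS.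
  apply: (le_trans (subadditive_mulnD subadd _ _ _ _ _)) => //; rewrite lerD2l.
  rewrite /C (bigD1 (Ordinal (ltn_pmod n.-1 (ltn0Sn k))))//= lerDl.
  by apply: sumr_ge0.
rewrite distrC ger0_norm ?subr_ge0// lerBlDr.
apply: (@le_trans _ _ (a k.+1 / k.+1%:R + C / n%:R)%R); last first.
  rewrite (splitr e) addrAC lerD// addrC; exact: ltW.
(* The quotient [q] of [n.-1] by [k.+1] satisfies [q * k.+1 <= n], hence
   [q * a k.+1 / n <= a k.+1 / k.+1]. *)
rewrite ler_pdivrMr// mulrDl divfK ?gt_eqF//; apply: (le_trans an).
rewrite lerD2r [leRHS]mulrAC ler_pdivlMr// mulrAC [leRHS]mulrC.
rewrite ler_wpM2r// -natrM ler_nat.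
by rewrite (leq_trans (leq_trunc_div _ _))// leq_pred.
Unshelve. all: by end_near. Qed.

(** * Joint likelihood ratios and their logarithms in the extended reals *)

Section LikelihoodRatio.
Context {d : measure_display} {T : measurableType d} {R : realType}.
Variable l : T -> \bar R.

Lemma joint_lr_ge0 : (forall x, 0 <= l x) ->
  forall n (y : n.-tuple T), 0 <= joint_lr l y.
Proof. by move=> l0 n y; apply: prode_ge0. Qed.

Lemma measurable_joint_lr : measurable_fun setT l ->
  forall n, measurable_fun setT (@joint_lr _ T R l n).
Proof.
move=> ml n; rewrite /joint_lr; elim: (index_enum _) => [|i s IHs].
  by under eq_fun do rewrite big_nil; exact: measurable_cst.
under eq_fun do rewrite big_cons; apply: emeasurable_funM => //.
by apply: measurableT_comp => //; exact: measurable_tnth.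
Qed.

(* The conventions [0 * +oo = 0] and [-oo + +oo = -oo] make [lne] additive on
   all of [0, +oo]. *)
Lemma lneM_ge0 (x y : \bar R) : 0 <= x -> 0 <= y ->
  lne (x * y) = lne x + lne y.
Proof.
have lne0 : @lne R 0 = -oo by rewrite le0_lneNy.
rewrite le_eqVlt => /predU1P[<- _|x0]; first by rewrite mul0e lne0 addNye.
rewrite le_eqVlt => /predU1P[<-|y0]; first by rewrite mule0 lne0 addeNy.
by rewrite lneM// in_itv/= leey andbT.
Qed.

Lemma lne_joint_lr : (forall x, 0 <= l x) ->
  forall n (y : n.-tuple T),
  lne (joint_lr l y) = \sum_(k < n) llr l (tnth y k).
Proof.
move=> l0 n y; rewrite /joint_lr; elim: (index_enum _) => [|i s IHs].
  by rewrite !big_nil lne1.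
by rewrite !big_cons lneM_ge0// ?IHs//; apply: prode_ge0.
Qed.

Lemma mean_llr_le n (y : n.-tuple T) (t : R) : (0 < n)%N ->
  (mean_llr l y <= t%:E) =
  (\sum_(k < n) llr l (tnth y k) <= (n%:R * t)%:E).
Proof. by move=> n0; rewrite /mean_llr lee_pdivrMl ?ltr0n. Qed.

Lemma lne_le_EFin (x : \bar R) (s : R) : 0 <= x ->
  (lne x <= s%:E) = (x <= (expR s)%:E).
Proof.
by move=> x0; rewrite -lee_expeR lneK// in_itv/= x0 leey.
Qed.

End LikelihoodRatio.

(** * Product laws and convergence of exponential rates *)

Section Iid.
Context {d : measure_display} {T : measurableType d} {R : realType}.

(** The first [m] and the last [n] observations are independent, and [C] contains the event that the
    former lie in [A] and the latter in [B]. *)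
Lemma iid_law_cat (G : probability T R) {m n}
    {A : set (m.-tuple T)} {B : set (n.-tuple T)} {C : set ((m + n).-tuple T)} :
  measurable A -> measurable B -> measurable C ->
  (forall y z, A y -> B z -> C [tuple of y ++ z]) ->
  iid_law G m A * iid_law G n B <= iid_law G (m + n) C.
Proof.
elim: m A C => [|m IHm] A C mA mB mC ABC.
  rewrite /= diracE; have [nilA|_] := boolP (_ \in A); last first.
    by rewrite mul0e.
  rewrite mul1e le_measure ?inE// => z Bz.
  have := ABC [tuple] z (set_mem nilA) Bz.
  by congr C; exact: val_inj.
pose consA := @Defs.cons_tuple _ T m @^-1` A.
pose consC := @Defs.cons_tuple _ T (m + n) @^-1` C.
have mconsA : measurable consA.
  by rewrite -[X in measurable X]setTI; exact: measurable_cons_tuple.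
have mconsC : measurable consC.
  by rewrite -[X in measurable X]setTI; exact: measurable_cons_tuple.
(* The product measure integrates the measures of sections over the first observation, so the
   induction hypothesis applies section by section. *)
rewrite /= /product_image /pushforward /product_measure1.
rewrite -ge0_integralZr//; last exact: measurable_fun_xsection.
apply: ge0_le_integral => //.
- by move=> x _; rewrite mule_ge0.
- apply: emeasurable_funM; last exact: measurable_cst.
  exact: measurable_fun_xsection.
- exact: measurable_fun_xsection.
- move=> x _; apply: IHm => //; [exact: measurable_xsection..|].
  move=> y z /xsectionP Ay Bz; apply/xsectionP.
  by have := ABC _ _ Ay Bz; congr C; exact: val_inj.
Qed.

Lemma measurable_all_tnth n {A : set T} : measurable A ->
  measurable [set y : n.-tuple T | forall i, A (tnth y i)].
Proof.
move=> mA; rewrite (_ : [set _ | _] =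
    \bigcap_(i in [set: 'I_n]) ((@tnth n T ^~ i) @^-1` A)).
  apply: fin_bigcap_measurable => // i _; rewrite -[X in measurable X]setTI.
  exact: measurable_tnth.
by apply/seteqP; split => [y yA i _|y yA i]; [exact: yA|exact: (yA i)].
Qed.

Lemma log_error_rate_le (G H : probability T R)
    (E : forall n, set (n.-tuple T)) n :
  iid_law G n (E n) <= iid_law H n (E n) ->
  log_error_rate G E n <= log_error_rate H E n.
Proof.
move=> GH; rewrite /log_error_rate lee_wpmul2l ?lee_fin ?invr_ge0//.
by rewrite lee_lne// in_itv/= leey andbT.
Qed.

(* The alternative [G A = 0] or [0 < G A] forces the probabilities of [E n],
   [n > 0], to vanish identically or never, so that Fekete's lemma applies to
   finite logarithms. *)
Lemma cvg_log_error_rate (G : probability T R) (A : set T)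
    (E : forall n, set (n.-tuple T)) :
  measurable A -> (forall n, measurable (E n)) ->
  (forall n (y : n.-tuple T), (0 < n)%N -> (forall i, A (tnth y i)) -> E n y) ->
  (forall n (y : n.-tuple T), (0 < n)%N ->
    (forall i, ~ A (tnth y i)) -> ~ E n y) ->
  (forall m n (y : m.-tuple T) (z : n.-tuple T), (0 < m)%N -> (0 < n)%N ->
    E m y -> E n z -> E (m + n)%N [tuple of y ++ z]) ->
  cvgn (log_error_rate G E).
Proof.
move=> mA mE AE AcEc Ecat.
(* If [G A = 0], almost every sample avoids [A] entirely, so [E n] is null for [n > 0] and the rate
   is eventually the constant [-oo]. *)
have [GA0|GA0] := eqVneq (G A) 0.
  apply: (@is_cvg_near_cst _ _ -oo); near=> n.
  have n0 : (0 < n)%N by near: n; exact: nbhs_infty_gt.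
  have EnA : E n `<=` ~` [set y | forall i, (~` A) (tnth y i)].
    by move=> y Ey Acy; exact: (AcEc n y n0 Acy Ey).
  have En0 : iid_law G n (E n) = 0.
    apply/eqP; rewrite eq_le measure_ge0 andbT.
    have mAc := measurable_all_tnth n (measurableC mA).
    apply: (@le_trans _ _
        (iid_law G n (~` [set y | forall i, (~` A) (tnth y i)]))).
      by apply: le_measure; rewrite ?inE; [exact: mE|exact: measurableC|].
    rewrite probability_setC// (iid_lawE G (fun=> measurableC mA)).
    rewrite big1 ?subee// => i _.
    by rewrite probability_setC// GA0 sube0.
  rewrite /log_error_rate En0 le0_lneNy// gt0_muleNy//.
  by rewrite lte_fin invr_gt0 ltr0n.
(* By independence, [E n] has probability at least [G A] to the power [n]. *)
have E_gt0 n : (0 < n)%N -> 0 < iid_law G n (E n).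
  move=> n0; apply: (@lt_le_trans _ _
      (iid_law G n [set y | forall i, A (tnth y i)])).
    rewrite (iid_lawE G (fun=> mA)).
    apply: (big_ind (fun x => 0 < x)) => // [x y x0 y0|i _].
      exact: mule_gt0.
    by rewrite lt0e GA0 measure_ge0.
  apply: le_measure; rewrite ?inE.
  - exact: measurable_all_tnth.
  - exact: mE.
  - by move=> y; exact: AE.
pose p n := fine (iid_law G n (E n)).
have pE n : iid_law G n (E n) = (p n)%:E.
  by rewrite fineK//; apply: fin_num_measure; exact: mE.
have p_gt0 n : (0 < n)%N -> (0 < p n)%R.
  by move=> n0; rewrite -lte_fin -pE E_gt0.
have p_le1 n : (p n <= 1)%R.
  by rewrite -lee_fin -pE; apply: probability_le1; exact: mE.
have pM m n : (0 < m)%N -> (0 < n)%N -> (p m * p n <= p (m + n)%N)%R.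
  move=> m0 n0; rewrite -lee_fin EFinM -!pE; apply: iid_law_cat => // y z.
  exact: Ecat.
have rate_cvg : cvgn (fun n => ((- ln (p n)) / n%:R)%R).
  apply: (@fekete _ (fun n => - ln (p n))%R) => [n|m n m0 n0].
    by rewrite oppr_ge0 ln_le0.
  have pmn0 : (0 < p (m + n)%N)%R by rewrite p_gt0// addn_gt0 m0.
  rewrite -opprD lerN2 -lnM ?posrE ?p_gt0// ler_ln ?posrE ?pM//.
  by rewrite mulr_gt0// p_gt0.
(* For [n > 0] the probability is positive and [lne] reduces to the real [ln]; equality for large
   [n] suffices for the limit. *)
have rateE : \forall n \near \oo,
    log_error_rate G E n = (- (- ln (p n) / n%:R))%:E.
  near=> n; have n0 : (0 < n)%N by near: n; exact: nbhs_infty_gt.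
  by rewrite /log_error_rate pE lne_EFin ?p_gt0// -EFinM mulNr opprK mulrC.
apply/cvg_ex; exists (- limn (fun n => - ln (p n) / n%:R)%R)%:E.
pose v n := (- (- ln (p n) / n%:R))%R.
apply: (@cvg_trans _ ((v n)%:E @[n --> \oo])).
  by apply: near_eq_cvg; near do apply/esym.
apply: cvg_EFin; [by near=> n|exact: cvgN].
Unshelve. all: by end_near. Qed.
End Iid.

(** The event [f x <= s] is the decreasing intersection of the events [f x < s + 1 / k.+1], so its
    probability is the limit of theirs. *)
Lemma le_probability_le {d} {T : measurableType d} {R : realType}
    {P Q : probability T R} {f : T -> \bar R} :
  measurable_fun setT f ->
  (forall t : R, P [set x | f x < t%:E] <= Q [set x | f x < t%:E]) ->
  forall s : R, P [set x | f x <= s%:E] <= Q [set x | f x <= s%:E].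
Proof.
move=> mf PQ s.
pose F k := [set x | f x < (s + k.+1%:R^-1)%:E].
have mF k : measurable (F k).
  by rewrite -[F k]setTI; exact: emeasurable_fun_infty_o.
have FE : \bigcap_k F k = [set x | f x <= s%:E].
  apply/seteqP; split => [x Fx|x /= fx k _ /=]; last first.
    by apply: (le_lt_trans fx); rewrite lte_fin ltrDl invr_gt0.
  apply/lee_addgt0Pr => e e0.
  have /ltr_add_invr[k ke] : (s < s + e)%R by rewrite ltrDl.
  by rewrite (le_trans (ltW (Fx k Logic.I)))// lee_fin ltW.
have ndF : nonincreasing_seq F.
  move=> m n mn; apply/subsetPset => x /lt_le_trans; apply.
  by rewrite lee_fin lerD2l lef_pV2 ?posrE// ler_nat ltnS.
have cvgF (G : probability T R) : G \o F @ \oo --> G [set x | f x <= s%:E].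
  rewrite -FE; apply: nonincreasing_cvg_mu => //.
    by rewrite (le_lt_trans (probability_le1 _ _))// ltry.
  exact: bigcap_measurable.
rewrite -(cvg_lim _ (cvgF P))// -(cvg_lim _ (cvgF Q))//.
apply: lee_lim; [by apply/cvg_ex; eexists; exact: cvgF..|].
by apply: nearW => k; exact: PQ.
Qed.

(** * The error events: measurability, stability under concatenation, rates and ordering *)

Section ErrorEvents.
Context {d : measure_display} {T : measurableType d} {R : realType}.
Variables (l : T -> \bar R) (t : R).
Hypotheses (ml : measurable_fun setT l) (l0 : forall x, 0 <= l x).

Let above n := [set y : n.-tuple T | t%:E < mean_llr l y].
Let below n := [set y : n.-tuple T | mean_llr l y <= t%:E].

Lemma below_joint_lr n : (0 < n)%N ->
  below n = [set y : n.-tuple T | joint_lr l y <= (expR (n%:R * t))%:E].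
Proof.
move=> n0; apply/funext => y; apply/propext; rewrite /below /=.
by rewrite mean_llr_le// -lne_joint_lr// lne_le_EFin// joint_lr_ge0.
Qed.

Lemma aboveE n : above n = ~` below n.
Proof.
apply/funext => y; apply/propext; rewrite /above /= ltNge.
by split => /negP.
Qed.

Lemma measurable_below n : measurable (below n).
Proof.
case: n => [|n].
  (* The empty sample has mean [0], so [below 0] is everything or nothing according to the sign of
     [t]. *)
  have [t0|t0] := leP 0%R t.
    rewrite (_ : below 0 = setT) //; apply/seteqP; split=> // y _ /=.
    by rewrite /below /mean_llr /= invr0 mul0e lee_fin.
  rewrite (_ : below 0 = set0) //; apply/seteqP; split=> // y /=.
  by rewrite /below /mean_llr /= invr0 mul0e lee_fin leNgt t0.
rewrite below_joint_lr// -[X in measurable X]setTI.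
by apply: emeasurable_fun_infty_c => //; exact: measurable_joint_lr.
Qed.

Lemma measurable_above n : measurable (above n).
Proof. by rewrite aboveE; apply: measurableC; exact: measurable_below. Qed.

Lemma sum_llr_cat m n (y : m.-tuple T) (z : n.-tuple T) :
  \sum_(k < m + n) llr l (tnth [tuple of y ++ z] k) =
  \sum_(k < m) llr l (tnth y k) + \sum_(k < n) llr l (tnth z k).
Proof.
rewrite big_split_ord /=; congr (_ + _); apply: eq_bigr => i _.
  by rewrite tnth_lshift.
by rewrite tnth_rshift.
Qed.

Lemma aboveP n (y : n.-tuple T) : (0 < n)%N ->
  above n y <-> (n%:R * t)%:E < \sum_(k < n) llr l (tnth y k).
Proof. by move=> n0; rewrite /above /= ltNge mean_llr_le// -ltNge. Qed.

Lemma belowP n (y : n.-tuple T) : (0 < n)%N ->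
  below n y <-> \sum_(k < n) llr l (tnth y k) <= (n%:R * t)%:E.
Proof. by move=> n0; rewrite /below /= mean_llr_le. Qed.

Lemma all_below n (y : n.-tuple T) : (0 < n)%N ->
  (forall i, llr l (tnth y i) <= t%:E) -> below n y.
Proof.
move=> n0 yt; apply/belowP => //.
rewrite (_ : (n%:R * t)%:E = \sum_(k < n) t%:E); first exact: lee_sum.
by rewrite sumEFin sumr_const card_ord mulr_natl.
Qed.

Lemma all_above n (y : n.-tuple T) : (0 < n)%N ->
  (forall i, t%:E < llr l (tnth y i)) -> above n y.
Proof.
(* The induction starts at sample size one, since the strict inequality fails for the empty sum. *)
move=> n0 yt; apply/aboveP => //; case: n n0 y yt => // n _ y yt.
elim: n y yt => [|n IHn] y yt; first by rewrite big_ord1 mul1r.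
case/tupleP: y yt => x y yt.
rewrite big_ord_recl -natr1 mulrDl mul1r addrC EFinD lteD//.
under eq_bigr do rewrite tnthS; apply: IHn => i.
by have := yt (lift ord0 i); rewrite tnthS.
Qed.

Lemma cat_below m n (y : m.-tuple T) (z : n.-tuple T) :
  (0 < m)%N -> (0 < n)%N -> below m y -> below n z ->
  below (m + n) [tuple of y ++ z].
Proof.
move=> m0 n0 /belowP-/(_ m0) ym /belowP-/(_ n0) zn.
apply/belowP; first by rewrite addn_gt0 m0.
by rewrite sum_llr_cat natrD mulrDl EFinD leeD.
Qed.

Lemma cat_above m n (y : m.-tuple T) (z : n.-tuple T) :
  (0 < m)%N -> (0 < n)%N -> above m y -> above n z ->
  above (m + n) [tuple of y ++ z].
Proof.
move=> m0 n0 /aboveP-/(_ m0) ym /aboveP-/(_ n0) zn.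
apply/aboveP; first by rewrite addn_gt0 m0.
by rewrite sum_llr_cat natrD mulrDl EFinD lteD.
Qed.

Lemma measurable_llr_le : measurable [set x | llr l x <= t%:E].
Proof.
rewrite (_ : [set _ | _] = [set x | l x <= (expR t)%:E]).
  by rewrite -[X in measurable X]setTI; exact: emeasurable_fun_infty_c.
by apply/funext => x; rewrite /llr /= lne_le_EFin.
Qed.

(** The single-observation event is [llr l x <= t]: if all observations satisfy it, so does their
    mean, and if none does, the mean exceeds [t]. *)
Lemma cvg_log_error_rate_below (G : probability T R) :
  cvgn (log_error_rate G below).
Proof.
apply: (@cvg_log_error_rate _ _ _ _ [set x | llr l x <= t%:E]).
- exact: measurable_llr_le.
- exact: measurable_below.
- by move=> n y; exact: all_below.
- move=> n y n0 ygt; have : above n y.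
    by apply: all_above => // i; rewrite ltNge; exact/negP/ygt.
  by rewrite aboveE.
- exact: cat_below.
Qed.

Lemma cvg_log_error_rate_above (G : probability T R) :
  cvgn (log_error_rate G above).
Proof.
apply: (@cvg_log_error_rate _ _ _ _ (~` [set x | llr l x <= t%:E])).
- by apply: measurableC; exact: measurable_llr_le.
- exact: measurable_above.
- by move=> n y n0 ygt; apply: all_above => // i; rewrite ltNge; exact/negP/ygt.
- move=> n y n0 yle; rewrite aboveE => nbelow; apply: nbelow.
  by apply: all_below => // i; exact: contrapT (yle i).
- exact: cat_above.
Qed.

Lemma le_below (P Q : probability T R) n : (0 < n)%N ->
  (forall s : R, iid_law P n [set y | joint_lr l y < s%:E] <=
                 iid_law Q n [set y | joint_lr l y < s%:E]) ->
  iid_law P n (below n) <= iid_law Q n (below n).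
Proof.
move=> n0 PQ; rewrite below_joint_lr//; apply: le_probability_le => //.
exact: measurable_joint_lr.
Qed.

(** Passing to complements reverses the order of [P] and [Q]. *)
Lemma le_above (P Q : probability T R) n : (0 < n)%N ->
  (forall s : R, iid_law P n [set y | joint_lr l y < s%:E] <=
                 iid_law Q n [set y | joint_lr l y < s%:E]) ->
  iid_law Q n (above n) <= iid_law P n (above n).
Proof.
move=> n0 PQ; have mb := measurable_below n.
by rewrite aboveE !probability_setC// leeB//; exact: le_below.
Qed.

End ErrorEvents.

Theorem mainTheorem1 (R : realType) (d : measure_display)
    (Omega : measurableType d) (mu : {measure set Omega -> \bar R})
    (C0 C1 : set (probability Omega R))
    (C0_ac : forall G, C0 G -> G `<< mu)
    (C1_ac : forall G, C1 G -> G `<< mu)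
    (Gh0 Gh1 : probability Omega R) (gh0 gh1 : Omega -> R)
    (Gh0_density : is_density mu Gh0 gh0)
    (Gh1_density : is_density mu Gh1 gh1)
    (lh : Omega -> \bar R) (lh_ratio : is_likelihood_ratio gh0 gh1 lh)
    (exp_moments : uniform_exp_moments C0 C1 lh) :
  FMR C0 C1 Gh0 Gh1 lh -> AMR C0 C1 Gh0 Gh1 lh.
Proof.
move=> [CGh0 CGh1 fmr]; have [ml l0 _] := lh_ratio.
split => // t _ G0 G1 CG0 CG1.
have cvg_above G := cvg_log_error_rate_above lh t ml l0 G.
have cvg_below G := cvg_log_error_rate_below lh t ml l0 G.
move=> above below; split; (split; first 2 last).
- apply: lee_lim; [exact: cvg_above..|near=> n].
  have n0 : (0 < n)%N by near: n; exact: nbhs_infty_gt.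
  (* Within [C0], [Gh0] gives the least mass to each event [joint_lr l y < s], hence the most to
     [above n]. *)
  apply: log_error_rate_le; apply: (le_above lh t ml l0 _ _ n n0) => s.
  by have [] := fmr n s G0 G1 n0 CG0 CG1.
- exact: cvg_above.
- exact: cvg_above.
- apply: lee_lim; [exact: cvg_below..|near=> n].
  have n0 : (0 < n)%N by near: n; exact: nbhs_infty_gt.
  (* Within [C1], [Gh1] gives the most mass to each event [joint_lr l y < s], hence the most to
     [below n]. *)
  apply: log_error_rate_le; apply: (le_below lh t ml l0 _ _ n n0) => s.
  by have [] := fmr n s G0 G1 n0 CG0 CG1.
- exact: cvg_below.
- exact: cvg_below.
Unshelve. all: by end_near. Qed.
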